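(* Let $\lambda=([0,1],\kappa)$ be a flat curve. Then $$\mathcal H^1_\kappa(\lambda)=\underline{\operatorname{Var}}(\lambda).$$
   Context: A quasi-metric on $[0,1]$ is a symmetric function $\kappa:[0,1]^2\to[0,\infty)$, vanishing exactly on the diagonal, with $\kappa(A,C)\le c(\kappa(A,B)+\kappa(B,C))$ for some constant $c\ge1$. The curve $\lambda=([0,1],\kappa)$ is called a flat curve if $\kappa$ is a quasi-metric on $[0,1]$, continuous with respect to the usual topology, such that $$|\kappa(A,B)+\kappa(B,C)-\kappa(A,C)|\le m(\kappa(A,C))\,\kappa(A,C)\quad\text{for all }0\le A\le B\le C\le1,$$ where $m:[0,\infty)\to[0,\infty)$ is non-decreasing and $m(t)\searrow0$ as $t\searrow0$. $\mathcal H^1_\kappa(\lambda)=\lim_{\varepsilon\to0}\inf\{\sum_i\operatorname{diam}_\kappa E_i: [0,1]\subset\bigcup_iE_i,\ \operatorname{diam}_\kappa E_i\le\varepsilon\}$ (value in $[0,+\infty]$). The lower variation is $$\underline{\operatorname{Var}}(\lambda)=\lim_{\delta\to0}\ \inf_{\|\sigma\|<\delta}\ \sum_{i=0}^n\kappa(A_i,A_{i+1})\in[0,+\infty],$$ the infimum being over all subdivisions $\sigma=\{0=A_0<A_1<\dots<A_n<A_{n+1}=1\}$ with $\|\sigma\|:=\max_i|A_i-A_{i+1}|<\delta$ (the same value is obtained with $\operatorname{diam}_\kappa([A_i,A_{i+1}])$ in place of $\kappa(A_i,A_{i+1})$). *)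

(* Defs.v *)
From mathcomp Require Import all_boot all_order all_algebra.
From mathcomp Require Import all_classical all_reals all_analysis.

Set Implicit Arguments.
Unset Strict Implicit.
Unset Printing Implicit Defensive.
Import Order.TTheory GRing.Theory Num.Theory.
Import numFieldNormedType.Exports.
Local Open Scope classical_set_scope.
Local Open Scope ring_scope.

Section flat_curve.
Context {R : realType}.

(* A function on [0, 1]^2 is represented by a total function on R^2; no
   definition below looks at its values outside [0, 1]^2. *)
Implicit Type kappa : R -> R -> R.

Definition quasi_metric kappa : Prop :=
  [/\ {in `[0, 1]%R &, forall A B, 0 <= kappa A B},
      {in `[0, 1]%R &, forall A B, kappa A B = kappa B A},
      {in `[0, 1]%R &, forall A B, kappa A B = 0 <-> A = B} &
      exists2 c : R, 1 <= c &
        {in `[0, 1]%R & &, forall A B C,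
          kappa A C <= c * (kappa A B + kappa B C)}].

(* As m is nonnegative and nondecreasing, m(t) tending to 0 from the right is
   the same as m(t) decreasing to 0. *)
Definition flat_curve kappa : Prop :=
  [/\ quasi_metric kappa,
      {within `[0, 1] `*` `[0, 1],
        continuous (fun p : R * R => kappa p.1 p.2)} &
      exists m : R -> R,
        [/\ {in `[0, +oo[%R, forall t, 0 <= m t},
            {in `[0, +oo[%R &, {homo m : s t / s <= t}},
            m t @[t --> 0^'+] --> (0 : R) &
            forall A B C : R, 0 <= A -> A <= B -> B <= C -> C <= 1 ->
              `|kappa A B + kappa B C - kappa A C|
                <= m (kappa A C) * kappa A C]].

(* The element 0 makes the diameter of the empty set 0 instead of -oo. *)
Definition kdiam kappa (E : set R) : \bar R :=
  ereal_sup (0%E |` [set (kappa p.1 p.2)%:E | p in E `*` E]).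

(* Finite covers are included, by padding with empty sets. *)
Definition hausdorff1_pre kappa (eps : R) : \bar R :=
  ereal_inf [set (\sum_(0 <= i <oo) kdiam kappa (E i))%E
            | E in [set E : nat -> set R |
                [/\ forall i, E i `<=` `[0, 1],
                    `[0, 1] `<=` \bigcup_i E i &
                    forall i, (kdiam kappa (E i) <= eps%:E)%E]]].

Definition hausdorff1 kappa : \bar R :=
  lim (hausdorff1_pre kappa eps @[eps --> 0^'+]).

(* A subdivision 0 = A_0 < A_1 < ... < A_{n+1} = 1 is encoded by the sequence
   s = [:: A_1; ...; A_{n+1}] with itv_partition 0 1 s, so A_i is
   nth 0 (0 :: s) i and size s = n + 1. *)
Definition subdiv_pt (s : seq R) (i : nat) : R := nth 0 (0 :: s) i.

Definition mesh (s : seq R) : R :=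
  \big[Num.max/0]_(0 <= i < size s) `|subdiv_pt s i - subdiv_pt s i.+1|.

Definition lower_variation_pre kappa (delta : R) : \bar R :=
  ereal_inf [set (\sum_(0 <= i < size s)
                    kappa (subdiv_pt s i) (subdiv_pt s i.+1))%:E
            | s in [set s | itv_partition 0 1 s /\ mesh s < delta]].

Definition lower_variation kappa : \bar R :=
  lim (lower_variation_pre kappa delta @[delta --> 0^'+]).

End flat_curve.

(* Main.v *)
(* Cutting along a fine subdivision gives a cover by segments [A, C], and
   flatness makes the diameter of a short segment at most (1 + eta) times
   kappa A C; hence the Hausdorff measure is at most the lower variation.
   Conversely each member E of a fine cover lies in an open interval on which
   kappa is at most (1 + eta) times diam E plus a summable error.  By
   compactness finitely many of these intervals cover [0, 1], and walking
   greedily from 0 to 1 through them gives a subdivision using each interval at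
   most once. *)

Require Import Defs.
From mathcomp Require Import all_boot all_order all_algebra.
From mathcomp Require Import all_classical all_reals all_analysis.
From mathcomp Require Import ring lra.

Set Implicit Arguments.
Unset Strict Implicit.
Unset Printing Implicit Defensive.
Import Order.TTheory GRing.Theory Num.Theory.
Import numFieldNormedType.Exports.
Local Open Scope classical_set_scope.
Local Open Scope ring_scope.

(** * Heine-Cantor on a compact subset, and comparison of limits of infima *)

Lemma compact_within_unif_continuous (R : realType) (S T : pseudoMetricType R)
    (K : set S) (f : S -> T) :
  compact K -> {within K, continuous f} ->
  forall e : R, 0 < e -> exists2 r : R, 0 < r &
    forall p q, K p -> K q -> ball p r q -> ball (f p) e (f q).
Proof.
move=> /compact_near_coveringP/near_covering_withinP cK cf e e0.
have : \forall r \near 0^'+,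
    K `<=` (fun p => forall q, K q -> ball p r q -> ball (f p) e (f q)).
  apply: cK => x Kx.
  have e20 : 0 < e / 2 by rewrite divr_gt0.
  have /(_ x Kx)/cvg_ballP/(_ _ e20) xe := (subspace_continuousP K f).1 cf.
  rewrite near_withinE -nbhs_ballE in xe.
  have [r /= r0 xr] := xe.
  have r20 : 0 < r / 2 by rewrite divr_gt0.
  (* With [p] within [r / 2] of [x] and a radius below [r / 2], both [p] and [q] stay in the ball of
     radius [r] about [x], so both values are [e / 2]-close to [f x]. *)
  exists (ball x (r / 2), [set i | 0 < i < r / 2]) => /=.
    split; first exact: nbhsx_ballx.
    by near=> i; apply/andP; split; near: i;
      [exact: nbhs_right_gt|exact: nbhs_right_lt].
  move=> [p i] /= [xp /andP[_ ir]] Kp q Kq pq.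
  rewrite [e]splitr; apply: (@ball_triangle _ _ (f x)).
    by apply: ball_sym; apply: xr => //; apply: le_ball xp; lra.
  apply: xr => //; rewrite [r]splitr.
  by apply: ball_triangle xp _; apply: le_ball pq; exact: ltW.
move=> KP; near (0 : R)^'+ => r; exists r => //.
move=> p q Kp; move: p Kp q; near: r; exact: KP.
Unshelve. all: by end_near. Qed.

Lemma lim_at_right_nonincreasing (R : realType) (f : R -> \bar R) :
  {in `]0, +oo[%R &, nonincreasing_fun f} ->
  lim (f x @[x --> 0^'+]) = ereal_sup (f @` `]0, +oo[).
Proof. by move=> nf; apply/cvg_lim => //; exact: nonincreasing_at_right_cvge. Qed.

(** Skeleton shared by both inequalities: [F] and [G] are the sets of cover sums and of subdivision
    sums, in either order. Only finite [y] need an estimate, since the claim is trivial when the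
    right-hand limit is infinite. *)
Lemma ereal_inf_lim_at_right_le (R : realType) (F G : R -> set (\bar R)) :
  {homo F : d e / d <= e >-> d `<=` e} -> {homo G : d e / d <= e >-> d `<=` e} ->
  (forall e y, 0 < e -> G e y -> (0 <= y)%E) ->
  (forall d eta : R, 0 < d -> 0 < eta -> exists2 e : R, 0 < e &
    forall y, G e y%:E -> (ereal_inf (F d) <= ((1 + eta) * y + eta)%:E)%E) ->
  (lim (ereal_inf (F d) @[d --> 0^'+]) <= lim (ereal_inf (G d) @[d --> 0^'+]))%E.
Proof.
move=> Fh Gh G0 FG.
rewrite !lim_at_right_nonincreasing; last first.
- by move=> d e _ _ de; apply: ereal_inf_le_tmp; exact: Fh.
- by move=> d e _ _ de; apply: ereal_inf_le_tmp; exact: Gh.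
set L := ereal_sup [set ereal_inf (G d) | d in _].
have GL e : 0 < e -> (ereal_inf (G e) <= L)%E.
  by move=> e0; apply: ereal_sup_ubound; exists e => //=; rewrite in_itv/= e0.
have L0 : (0 <= L)%E.
  by apply: le_trans (GL _ ltr01); apply/ereal_infP => y; exact: G0.
apply/ereal_supP => _ [d /= + <-]; rewrite in_itv/= andbT => d0.
have [->|Lfin] := eqVneq L +oo%E; first exact: leey.
have [l Ll] : exists l, L = l%:E by case: L L0 Lfin {GL} => // l; exists l.
rewrite Ll lee_fin in L0 GL *.
apply/lee_addgt0Pr => t t0.
(* For [y < l + eta] the bound [(1 + eta) * y + eta] is at most [l + eta * (l + 2 + eta)], hence at
   most [l + eta * (l + 3) <= l + t]. *)
pose eta := Num.min 1 (t / (l + 3)).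
have eta0 : 0 < eta by rewrite /eta lt_min ltr01 divr_gt0//; lra.
have eta1 : eta <= 1 by rewrite /eta ge_min lexx.
have etat : eta * (l + 3) <= t.
  by rewrite -ler_pdivlMr ?ge_min ?lexx ?orbT//; lra.
have [e e0 He] := FG d eta d0 eta0.
have /ereal_inf_ltP[y Gy] : (ereal_inf (G e) < (l + eta)%:E)%E.
  by apply: le_lt_trans (GL _ e0) _; rewrite lte_fin; lra.
have := G0 _ _ e0 Gy; case: y Gy => // y Gy; rewrite lee_fin lte_fin => y0 yl.
apply: le_trans (He _ Gy) _; rewrite lee_fin; nra.
Qed.

(** * Subdivisions, and their extraction from finite interval covers *)

Lemma mesh_ltP (R : realType) (s : seq R) (d : R) : 0 < d ->
  mesh s < d <->
  forall i, (i < size s)%N -> `|subdiv_pt s i - subdiv_pt s i.+1| < d.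
Proof.
move=> d0; rewrite /mesh big_mkord; split.
  by move=> /bigmax_ltP[_ sd] i si; exact: (sd (Ordinal si)).
by move=> sd; apply/bigmax_ltP; split => // i _; exact: sd.
Qed.

Lemma itv_partition_cover (R : realType) (a b x : R) (s : seq R) :
  itv_partition a b s -> a <= x <= b ->
  exists i, nth b (a :: s) i <= x <= nth b (a :: s) i.+1.
Proof.
elim: s a => [|h t ih] a.
  by move=> _ axb; exists 0%N.
move=> /itv_partition_cons /ih{}ih /andP[ax xb].
have [xh|hx] := leP x h; first by exists 0%N => /=; rewrite ax.
have [|i hi] := ih; first by rewrite (ltW hx).
by exists i.+1.
Qed.

(** Projection onto [[a, b]] is monotone and moves a point of the widened interval by at most [r].
    It brings pairs of the widened interval back to where flatness controls [kappa]. *)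
Lemma clamp_pair (R : realType) (a b r u v : R) :
  a <= b -> 0 <= r -> a - r <= u -> u <= v -> v <= b + r ->
  exists u' v', [/\ a <= u', u' <= v', v' <= b, `|u - u'| <= r & `|v - v'| <= r].
Proof.
move=> ab r0 au uv vb.
pose clamp x := Num.max a (Num.min x b).
have clampP x : a - r <= x -> x <= b + r ->
    [/\ a <= clamp x, clamp x <= b & `|x - clamp x| <= r].
  move=> ax xb; rewrite /clamp ler_norml.
  have [?|?] := leP x b; first by have [?|?] := leP a x; split; lra.
  by rewrite max_r//; split; lra.
have [au' ub' uu'] := clampP u au (le_trans uv vb).
have [av' vb' vv'] := clampP v (le_trans au uv) vb.
exists (clamp u), (clamp v); split => //.
by apply: le_max2 => //; exact: le_min2.
Qed.

(* Greedy traversal: if [x] lies in [`]p i, q i[`], jump from [x] to [q i]; the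
   interval [i] meets nothing to the right of [q i], so it can be discarded. *)
Lemma cover_subdivision (R : realType) (kappa : R -> R -> R) (I : eqType)
    (D : seq I) (p q w : I -> R) (d x b : R) :
  (forall i, 0 <= w i) -> x <= b ->
  (forall y, x <= y <= b -> exists2 i, i \in D & p i < y < q i) ->
  (forall i u v, p i <= u -> u <= v -> v <= q i -> x <= u -> v <= b ->
     kappa u v <= w i /\ `|u - v| < d) ->
  exists s, [/\ itv_partition x b s,
    \sum_(0 <= j < size s) kappa (nth 0 (x :: s) j) (nth 0 (x :: s) j.+1)
      <= \sum_(i <- D) w i &
    forall j, (j < size s)%N ->
      `|nth 0 (x :: s) j - nth 0 (x :: s) j.+1| < d].
Proof.
move=> w0; have [n] := ubnP (size D); elim: n => // n ih in D x *.
rewrite ltnS => Dn xb xDb kw.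
have [<-|xneb] := eqVneq x b.
  exists [::]; split => //.
  by rewrite big_geq// sumr_ge0.
have {xneb} xb' : x < b by rewrite lt_neqAle xneb.
have [i iD /andP[px xq]] := xDb x (introT andP (conj (lexx x) xb)).
have [bq|qb] := leP b (q i).
  have [kxb dxb] := kw i x b (ltW px) xb bq (lexx x) (lexx b).
  exists [:: b]; split => /=.
  - exact: itv_partition1.
  - rewrite big_nat1 /= (big_rem i iD) /= (le_trans kxb)// lerDl.
    by rewrite sumr_ge0.
  - by case.
have [kxq dxq] := kw i x (q i) (ltW px) (ltW xq) (lexx _) (lexx x) (ltW qb).
have [||||s [sp ss sd]] := ih (rem i D) (q i).
- apply: leq_trans Dn; rewrite size_rem//.
  by case: (D) iD.
- exact: ltW.
- move=> y /andP[qy yb]; have [|j jD /andP[pj jq]] := xDb y.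
    by rewrite yb (ltW (lt_le_trans xq qy)).
  exists j; last by rewrite pj.
  move: jD; rewrite (perm_mem (perm_to_rem iD)) inE => /orP[/eqP ji|//].
  by move: jq; rewrite ji ltNge qy.
- move=> j u v pu uv vq qu vb; apply: kw => //.
  exact: le_trans (ltW xq) qu.
exists (q i :: s); split.
- by case: sp => sp sb; split => //=; rewrite xq.
- by rewrite /= big_nat_recl//= (big_rem i iD)/= lerD.
- by case.
Qed.

(** The lemmas on [itv_partition] take the right endpoint 1 as default value, whereas [subdiv_pt]
    takes 0. *)
Lemma subdiv_ptE (R : realType) (s : seq R) i : (i <= size s)%N ->
  nth 1 (0 :: s) i = subdiv_pt s i.
Proof. by move=> si; exact: set_nth_default. Qed.

Lemma subdiv_pt01 (R : realType) (s : seq R) i :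
  itv_partition 0 1 s -> (i <= size s)%N -> 0 <= subdiv_pt s i <= 1.
Proof.
move=> sp si; rewrite -subdiv_ptE//.
by rewrite itv_partition_nth_ge// itv_partition_nth_le.
Qed.

Section kappa_diameter.
Context {R : realType} (kappa : R -> R -> R).
Implicit Types E : set R.

Lemma kdiam_ge0 E : (0 <= kdiam kappa E)%E.
Proof. by apply: ereal_sup_ubound; left. Qed.

Lemma kdiam_ge E u v : E u -> E v -> ((kappa u v)%:E <= kdiam kappa E)%E.
Proof. by move=> Eu Ev; apply: ereal_sup_ubound; right; exists (u, v). Qed.

Lemma kdiam_le E (x : R) : 0 <= x -> (forall u v, E u -> E v -> kappa u v <= x) ->
  (kdiam kappa E <= x%:E)%E.
Proof.
move=> x0 Ex; apply/ereal_supP => _ [->|[[u v] [/= Eu Ev] <-]].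
  by rewrite lee_fin.
by rewrite lee_fin Ex.
Qed.

End kappa_diameter.

(** * Local geometry of a flat curve *)

Section flat_curve.
Context {R : realType} {kappa : R -> R -> R} (hk : flat_curve kappa).

Let kappa_ge0 A B : 0 <= A <= 1 -> 0 <= B <= 1 -> 0 <= kappa A B.
Proof. by case: hk => -[k0 _ _ _] _ _ A01 B01; apply: k0; rewrite in_itv. Qed.

Let kappaC A B : 0 <= A <= 1 -> 0 <= B <= 1 -> kappa A B = kappa B A.
Proof. by case: hk => -[_ k0 _ _] _ _ A01 B01; apply: k0; rewrite in_itv. Qed.

Let kappa_eq0 A B : 0 <= A <= 1 -> 0 <= B <= 1 -> kappa A B = 0 <-> A = B.
Proof. by case: hk => -[_ _ k0 _] _ _ A01 B01; apply: k0; rewrite in_itv. Qed.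

(* Two applications of flatness, to [A, B', C] and then to [A, B, B']. *)
Lemma flat_curve_subinterval (eta : R) : 0 < eta -> exists2 t : R, 0 < t &
  forall A B B' C, 0 <= A -> A <= B -> B <= B' -> B' <= C -> C <= 1 ->
    kappa A C <= t -> kappa B B' <= (1 + eta) * kappa A C.
Proof.
move=> eta0; have [_ _ [m [m0 mh mc flat]]] := hk.
(* Two applications of flatness cost [(1 + e) ^ 2 <= 1 + 3 * e <= 1 + eta], using [e <= 1]. *)
pose e := Num.min 1 (eta / 3).
have e0 : 0 < e by rewrite lt_min ltr01 divr_gt0.
have e1 : e <= 1 by rewrite ge_min lexx.
have e3 : e * 3 <= eta by rewrite -ler_pdivlMr// ge_min lexx orbT.
have [t t0 mt] : exists2 t, 0 < t & m t <= e.
  have /cvgr_lt /(_ e e0) H := mc.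
  near (0 : R)^'+ => t; exists t => //.
  apply: ltW; near: t; exact: H.
(* Flatness bounds the sum [kappa A B + kappa B C], and both terms are nonnegative. *)
have part A B C : 0 <= A -> A <= B -> B <= C -> C <= 1 -> kappa A C <= t ->
    kappa A B <= (1 + e) * kappa A C /\ kappa B C <= (1 + e) * kappa A C.
  move=> A0 AB BC C1 kt.
  have A01 : 0 <= A <= 1 by lra.
  have B01 : 0 <= B <= 1 by lra.
  have C01 : 0 <= C <= 1 by lra.
  have k0 := kappa_ge0 A01 C01.
  have mke : m (kappa A C) <= e.
    by apply: le_trans mt; apply: mh; rewrite ?in_itv/= ?andbT// ltW.
  have := flat A B C A0 AB BC C1; rewrite ler_norml => /andP[_ H].
  have := kappa_ge0 A01 B01; have := kappa_ge0 B01 C01.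
  by split; nra.
(* Halving leaves room for the second application: [kappa A B' <= (1 + e) * kappa A C <= 2 * (t /
   2)]. *)
exists (t / 2); first by rewrite divr_gt0.
move=> A B B' C A0 AB BB B'C C1 kt.
have k0 : 0 <= kappa A C by apply: kappa_ge0; lra.
have [|kAB' _] := part A B' C A0 (le_trans AB BB) B'C C1; first lra.
have [||_ kBB'] := part A B B' A0 AB BB; [lra|nra|].
have ee : (1 + e) * (1 + e) <= 1 + eta by nra.
apply: le_trans (ler_wpM2r k0 ee); rewrite -mulrA.
by apply: le_trans kBB' _; apply: ler_wpM2l => //; lra.
Unshelve. all: by end_near. Qed.

Let compact_square : compact (`[0, 1] `*` `[0, 1] : set (R * R)).
Proof. by apply: compact_setX; exact: segment_compact. Qed.

Lemma flat_curve_unif_continuous (e : R) : 0 < e -> exists2 r : R, 0 < r &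
  forall u v u' v', 0 <= u <= 1 -> 0 <= v <= 1 -> 0 <= u' <= 1 -> 0 <= v' <= 1 ->
    `|u - u'| < r -> `|v - v'| < r -> `|kappa u v - kappa u' v'| < e.
Proof.
move=> e0; have [_ kc _] := hk.
have [r r0 kr] := compact_within_unif_continuous compact_square kc e0.
exists r => // u v u' v' u1 v1 u1' v1' uu vv.
by apply: (kr (u, v) (u', v')); split; rewrite //= in_itv.
Qed.

(** On the compact set of pairs at distance at least [d], [kappa] attains its minimum, which is
    positive because [kappa] vanishes only on the diagonal. This is how small values of [kappa]
    yield a small mesh. *)
Lemma flat_curve_small (d : R) : 0 < d -> exists2 t : R, 0 < t &
  forall u v, 0 <= u <= 1 -> 0 <= v <= 1 -> kappa u v < t -> `|u - v| < d.
Proof.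
move=> d0; have [_ kc _] := hk.
pose K := `[0, 1] `*` `[0, 1] `&` [set p : R * R | d <= `|p.1 - p.2|].
have [K0|/eqP/negP/negP/set0P K0] := pselect (K = set0).
  exists 1 => // u v u1 v1 _; rewrite ltNge; apply/negP => duv.
  have : K (u, v) by split => //; split; rewrite /= in_itv.
  by rewrite K0.
have [||[u v]] := @compact_EVT_min _ _ (fun p => kappa p.1 p.2) K K0.
- apply: (subclosed_compact _ compact_square); last by move=> ? [].
  apply: closedI; first exact: compact_closed.
  apply: (@preimage_closed _ _ (fun p : R * R => `|p.1 - p.2|) [set x | d <= x]).
    move=> p _; apply: cvg_norm; apply: cvgB; [exact: cvg_fst|exact: cvg_snd].
  exact: closed_ge.
- apply: continuous_subspaceW kc; exact: subIsetl.
rewrite inE /= => -[[/=]]; rewrite !in_itv/= => u1 v1 duv kmin.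
exists (kappa u v).
  rewrite lt_neqAle kappa_ge0// andbT eq_sym; apply/eqP => /kappa_eq0-/(_ u1 v1) uv.
  by move: duv; rewrite uv subrr normr0 leNgt d0.
move=> u' v' u1' v1'; apply: contraTT; rewrite -!leNgt => duv'.
by apply: (kmin (u', v')); rewrite inE; split => //; split; rewrite /= in_itv.
Qed.

Let kappaxx A : 0 <= A <= 1 -> kappa A A = 0.
Proof. by move=> A01; apply/kappa_eq0. Qed.

(* A small set sits in an open interval whose [kappa]-lengths are controlled by
   its diameter: widen the segment between two near-extremal points of [E]. *)
Lemma kdiam_open_hull (eta : R) : 0 < eta -> exists2 t : R, 0 < t &
  forall E : set R, E `<=` `[0, 1] -> (kdiam kappa E <= t%:E)%E ->
  forall e : R, 0 < e -> exists pq : R * R, (E `<=` `]pq.1, pq.2[) /\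
    forall u v, pq.1 <= u -> u <= v -> v <= pq.2 -> 0 <= u -> v <= 1 ->
      kappa u v <= (1 + eta) * fine (kdiam kappa E) + e.
Proof.
move=> eta0; have [t t0 kt] := flat_curve_subinterval eta0.
exists t => // E E01 Et e e0.
have := kdiam_ge0 kappa E.
have [d Ed] : exists d, kdiam kappa E = d%:E.
  have := kdiam_ge0 kappa E.
  by case: (kdiam kappa E) Et => // d _ _; exists d.
rewrite Ed /= lee_fin => d0; rewrite Ed lee_fin in Et.
have [E0|/eqP/negP/negP/set0P [z Ez]] := pselect (E = set0).
  (* The open interval is empty, and its closed version contains only the pair [u = v = 0]. *)
  exists (0, 0) => /=; split; first by rewrite E0.
  move=> u v u0 uv v0 _ _; have -> : u = 0 by lra.
  have -> : v = 0 by lra.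
  rewrite kappaxx ?lexx ?ler01//; nra.
have E01' x : E x -> 0 <= x <= 1 by move=> /E01; rewrite /= in_itv.
have lbE : has_lbound E by exists 0 => x /E01' /andP[].
have ubE : has_ubound E by exists 1 => x /E01' /andP[].
have [r r0 kr] := flat_curve_unif_continuous e0.
have r20 : 0 < r / 2 by rewrite divr_gt0.
have [a0 Ea0 a0E] := @inf_adherent _ E _ r20 (conj (ex_intro _ z Ez) lbE).
have [b0 Eb0 b0E] := @sup_adherent _ E _ r20 (conj (ex_intro _ z Ez) ubE).
(* The near-extremal points may come in the wrong order; exchanging them then only brings each
   closer to its extremum. *)
have [a [b [Ea Eb ab aa0 bb0]]] : exists a b,
    [/\ E a, E b, a <= b, a <= a0 & b0 <= b].
  have [ab|ba] := leP a0 b0; first by exists a0, b0.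
  by exists b0, a0; split => //; exact: ltW.
have kab : kappa a b <= d by rewrite -lee_fin -Ed; exact: kdiam_ge.
have /andP[a1 _] := E01' _ Ea; have /andP[_ b1] := E01' _ Eb.
(* The margin [r / 2] passes strictly beyond the infimum and supremum of [E], yet clamping moves
   points by less than [r], so [kappa] changes by less than [e]. *)
exists (a - r / 2, b + r / 2) => /=; split.
  move=> x Ex; rewrite /= in_itv/=.
  have := ge_inf lbE Ex; have := ub_le_sup ubE Ex; lra.
move=> u v au uv vb u0 v1.
have [u' [v' [au' uv' vb' uu' vv']]] := clamp_pair ab (ltW r20) au uv vb.
have k1 : kappa u' v' <= (1 + eta) * kappa a b.
  by apply: kt => //; exact: le_trans kab Et.
have k2 : `|kappa u v - kappa u' v'| < e.
  by apply: kr; rewrite ?(le_lt_trans uu') ?(le_lt_trans vv')//; lra.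
have k3 : (1 + eta) * kappa a b <= (1 + eta) * d.
  by apply: ler_wpM2l => //; lra.
move: k2; rewrite ltr_norml => /andP[_]; lra.
Qed.

(** * Comparison of the two infima at a fixed scale *)

Lemma hausdorff1_pre_le (eps eta : R) : 0 < eps -> 0 < eta ->
  exists2 d : R, 0 < d & forall s, itv_partition 0 1 s -> mesh s < d ->
  (hausdorff1_pre kappa eps <=
    ((1 + eta) * \sum_(0 <= i < size s)
       kappa (subdiv_pt s i) (subdiv_pt s i.+1))%:E)%E.
Proof.
move=> eps0 eta0; have [t t0 kt] := flat_curve_subinterval eta0.
(* The first bound makes flatness applicable to each segment; the second keeps the diameters, at
   most [(1 + eta) * t'], below [eps]. *)
pose t' := Num.min t (eps / (1 + eta)).
have t'0 : 0 < t' by rewrite lt_min t0 divr_gt0//; lra.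
have t't : t' <= t by rewrite ge_min lexx.
have t'e : (1 + eta) * t' <= eps.
  by rewrite mulrC -ler_pdivlMr ?ge_min ?lexx ?orbT//; lra.
have [r r0 kr] := flat_curve_unif_continuous t'0.
exists r => // s sp /(mesh_ltP _ r0) sr.
(* Past the end of [s], the default value makes [E i] the null set {1}. *)
pose A i := nth 1 (0 :: s) i.
have A01 i : 0 <= A i <= 1.
  have [si|si] := leqP i (size s); first by rewrite /A subdiv_ptE// subdiv_pt01.
  by rewrite /A nth_default ?ler01 ?lexx.
have Asize i : (size s <= i)%N -> A i = 1.
  rewrite leq_eqVlt => /predU1P[<-|si]; last by rewrite /A nth_default.
  exact: itv_partition_nth_size sp.
have AS i : A i <= A i.+1.
  have [si|si] := ltnP i (size s); last first.
    by rewrite [A i.+1]nth_default//; have /andP[] := A01 i.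
  exact: (@nondecreasing_fun_itv_partition _ _ 0 1 id s _ sp).
have kA i : kappa (A i) (A i.+1) < t'.
  have [si|si] := ltnP i (size s).
    (* Comparison with the diagonal pair, where [kappa] is 0. *)
    have := kr (A i) (A i.+1) (A i.+1) (A i.+1) (A01 _) (A01 _) (A01 _) (A01 _).
    rewrite (kappaxx (A01 _)) subr0 subrr normr0 => /(_ _ r0) H.
    apply: le_lt_trans (ler_norm _) (H _).
    by rewrite /A !subdiv_ptE//; [exact: sr|exact: ltnW].
  by rewrite !Asize ?kappaxx ?ler01 ?lexx// (leq_trans si).
pose E i := `[A i, A i.+1]%classic.
have dE i : (kdiam kappa (E i) <= ((1 + eta) * kappa (A i) (A i.+1))%:E)%E.
  have /andP[Ai0 _] := A01 i; have /andP[_ Ai1] := A01 i.+1.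
  have Ak := kappa_ge0 (A01 i) (A01 i.+1).
  have kiA u v : A i <= u -> u <= v -> v <= A i.+1 ->
      kappa u v <= (1 + eta) * kappa (A i) (A i.+1).
    by move=> Au uv vA; apply: kt => //; exact: le_trans (ltW (kA i)) t't.
  apply: kdiam_le; first by rewrite mulr_ge0//; lra.
  move=> u v; rewrite /E /= !in_itv/= => /andP[Au uA] /andP[Av vA].
  have [uv|/ltW vu] := leP u v; first exact: kiA.
  by rewrite kappaC ?kiA//; lra.
apply: (@le_trans _ _ (\sum_(0 <= i <oo) kdiam kappa (E i))%E).
  apply: ereal_inf_lbound; exists E => //; split.
  - move=> i x; rewrite /E /= !in_itv/=.
    have := A01 i; have := A01 i.+1; lra.
  - move=> x; rewrite /= in_itv/= => x01.
    by have [i Ai] := itv_partition_cover sp x01; exists i; rewrite // /E /= in_itv.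
  - move=> i; apply: le_trans (dE i) _; rewrite lee_fin (le_trans _ t'e)//.
    by rewrite ler_wpM2l ?ltW//; lra.
rewrite (nneseries_split _ (size s)) => [|k _]; last exact: kdiam_ge0.
rewrite eseries0 ?adde0 => [|i si _]; last first.
  apply/eqP; rewrite eq_le kdiam_ge0 andbT.
  by apply: le_trans (dE i) _; rewrite !Asize ?kappaxx ?mulr0 ?ler01 ?lexx// ltnW.
rewrite add0n mulr_sumr -sumEFin !big_seq lee_sum// => i.
rewrite mem_index_iota => /andP[_ si]; apply: le_trans (dE i) _.
by rewrite /A !subdiv_ptE// ltnW.
Qed.

Lemma lower_variation_pre_le (d eta : R) : 0 < d -> 0 < eta ->
  exists2 eps : R, 0 < eps & forall (E : nat -> set R) (y : R),
    (forall i, E i `<=` `[0, 1]) -> `[0, 1] `<=` \bigcup_i E i ->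
    (forall i, (kdiam kappa (E i) <= eps%:E)%E) ->
    (\sum_(0 <= i <oo) kdiam kappa (E i))%E = y%:E ->
  (lower_variation_pre kappa d <= ((1 + eta) * y + eta)%:E)%E.
Proof.
move=> d0 eta0; have [t t0 ht] := kdiam_open_hull eta0.
have [r r0 kr] := flat_curve_small d0.
(* Besides allowing open hulls, [eps] makes the main part of each weight [w i] at most [r / 2]; the
   error, below [e <= r / 2], takes up the rest. Thus [w i < r], as [flat_curve_small] demands. *)
pose eps := Num.min t (r / 2 / (1 + eta)).
have eps0 : 0 < eps by rewrite lt_min t0 !divr_gt0//; lra.
have epst : eps <= t by rewrite ge_min lexx.
have epsr : (1 + eta) * eps <= r / 2.
  by rewrite mulrC -ler_pdivlMr ?ge_min ?lexx ?orbT//; lra.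
pose e := Num.min eta (r / 2).
have e0 : 0 < e by rewrite lt_min eta0 divr_gt0.
exists eps => // E y E01 Ecov Eeps Ey.
have ei0 i : 0 < e / 2 ^+ i.+1 by rewrite divr_gt0// exprn_gt0.
have Et i : (kdiam kappa (E i) <= t%:E)%E.
  by apply: le_trans (Eeps i) _; rewrite lee_fin.
(* The hull of [E i] is allowed the error [e / 2 ^+ i.+1], so that all errors together stay below
   [e <= eta]. *)
have [pq hpq] := choice (fun i => ht (E i) (E01 i) (Et i) _ (ei0 i)).
pose D i := fine (kdiam kappa (E i)).
have ED i : kdiam kappa (E i) = (D i)%:E.
  rewrite /D fineK// ge0_fin_numE ?kdiam_ge0//.
  by apply: le_lt_trans (Eeps i) _; rewrite ltry.
have D0 i : 0 <= D i by rewrite -lee_fin -ED kdiam_ge0.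
pose w i := (1 + eta) * D i + e / 2 ^+ i.+1.
have w0 i : 0 <= w i by rewrite addr_ge0 ?mulr_ge0 ?(ltW (ei0 i))//; lra.
have wr i : w i < r.
  have eir : e / 2 ^+ i.+1 < r / 2.
    have er : e <= r / 2 by rewrite ge_min lexx orbT.
    apply: lt_le_trans er; rewrite ltr_pdivrMr ?exprn_gt0//.
    by rewrite ltr_pMr// exprn_egt1// ltr1n.
  have Deps : (1 + eta) * D i <= (1 + eta) * eps.
    apply: ler_wpM2l; first by lra.
    by rewrite -lee_fin -ED.
  rewrite /w; lra.
have [F _ Fcov] : finite_subset_cover setT (fun i => `](pq i).1, (pq i).2[%classic)
    (`[0, 1] : set R).
  have := @segment_compact R 0 1; rewrite compact_cover; apply.
    by move=> i _; exact: interval_open.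
  by move=> x /Ecov[i _ Eix]; exists i => //; exact: (hpq i).1.
(* Enlarging the finite subcover to an initial segment of indices keeps it a cover and turns the sum
   of diameters into a partial sum of the series, hence at most [y]. *)
pose N := (\max_(i <- finmap.enum_fset F) i).+1.
have [|||s [sp ssum sd]] := @cover_subdivision R kappa nat (index_iota 0 N)
  (fun i => (pq i).1) (fun i => (pq i).2) w d 0 1 w0.
- exact: ler01.
- move=> x x01.
  have [|i iF] := Fcov x; first by rewrite /= in_itv.
  rewrite /= in_itv/= => xi; exists i => //.
  by rewrite mem_index_iota /N ltnS (@leq_bigmax_seq _ _ xpredT id).
- move=> i u v pu uv vq u0 v1.
  have kw : kappa u v <= w i by exact: (hpq i).2.
  split => //; apply: kr; [lra|lra|].
  exact: le_lt_trans kw (wr i).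
apply: (@le_trans _ _ (\sum_(i <- index_iota 0 N) w i)%:E).
  apply: (@le_trans _ _ (\sum_(0 <= j < size s)
    kappa (subdiv_pt s j) (subdiv_pt s j.+1))%:E); last by rewrite lee_fin.
  by apply: ereal_inf_lbound; exists s => //; split => //; apply/mesh_ltP.
have sumD : \sum_(0 <= i < N) D i <= y.
  rewrite -lee_fin -Ey -sumEFin; under eq_bigr do rewrite -ED.
  by apply: nneseries_lim_ge => i _ _; exact: kdiam_ge0.
have sume n : \sum_(0 <= i < n) e / 2 ^+ i.+1 = e - e / 2 ^+ n.
  elim: n => [|n ih]; first by rewrite big_geq// expr0 divr1 subrr.
  by rewrite big_nat_recr//= ih exprS; field; rewrite expf_neq0.
have ee : e <= eta by rewrite ge_min lexx.
have eN : 0 < e / 2 ^+ N by rewrite divr_gt0// exprn_gt0.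
rewrite lee_fin big_split/= sume -mulr_sumr.
have : (1 + eta) * \sum_(0 <= i < N) D i <= (1 + eta) * y.
  by rewrite ler_wpM2l//; lra.
lra.
Qed.

End flat_curve.

Theorem proposition5p9 (R : realType) (kappa : R -> R -> R)
    (hkappa : flat_curve kappa) :
  hausdorff1 kappa = lower_variation kappa.
Proof.
have [[k0 _ _ _] _ _] := hkappa.
apply/eqP; rewrite eq_le; apply/andP; split.
- apply: ereal_inf_lim_at_right_le.
  + move=> d e de _ [E [E01 Ecov Ed] <-]; exists E => //; split => // i.
    by apply: le_trans (Ed i) _; rewrite lee_fin.
  + move=> d e de _ [s [sp sd] <-]; exists s => //; split => //.
    exact: lt_le_trans sd de.
  + move=> e _ _ [s [sp _] <-]; rewrite lee_fin big_nat sumr_ge0// => i /andP[_ si].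
    by apply: k0; rewrite in_itv/= subdiv_pt01// ltnW.
  + move=> d eta d0 eta0; have [r r0 H] := hausdorff1_pre_le hkappa d0 eta0.
    exists r => // _ [s [sp sd] [<-]]; apply: le_trans (H s sp sd) _.
    by rewrite lee_fin lerDl ltW.
- apply: ereal_inf_lim_at_right_le.
  + move=> d e de _ [s [sp sd] <-]; exists s => //; split => //.
    exact: lt_le_trans sd de.
  + move=> d e de _ [E [E01 Ecov Ed] <-]; exists E => //; split => // i.
    by apply: le_trans (Ed i) _; rewrite lee_fin.
  + move=> e _ _ [E _ <-]; apply: nneseries_ge0 => i _ _; exact: kdiam_ge0.
  + move=> d eta d0 eta0; have [r r0 H] := lower_variation_pre_le hkappa d0 eta0.
    by exists r => // y [E [E01 Ecov Ed]]; exact: H.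
Qed.
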